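(* Let $X,Y$ be infinite dimensional Hilbert spaces, and let $B:\mathcal D(B)\subset X\to X$ be a densely defined, unbounded, linear self-adjoint operator for which there is $m>0$ with $\|Bx\|_X\ge m\|x\|_X$ for all $x\in\mathcal D(B)$. Let $F:\mathcal D(F)\subseteq X\to Y$ be a (in general non-linear) sequentially weakly continuous operator whose domain $\mathcal D(F)$ is a convex and closed subset of $X$, and suppose that $\mathcal D:=\mathcal D(F)\cap\mathcal D(B)\neq\emptyset$. Let $y\in Y$, let $x^\dagger\in\mathcal D(F)$ satisfy $F(x^\dagger)=y$, and let $\bar x\in\mathcal D$. Assume: (i) (non-linearity structure) there are $a>0$ and constants $0<c_a\le C_a<\infty$ such that $$c_a\|x-x^\dagger\|_{-a}\le\|F(x)-F(x^\dagger)\|_Y\le C_a\|x-x^\dagger\|_{-a}\quad\text{for all }x\in\mathcal D;$$ (ii) (solution smoothness) there are $0<p<1$ and $E<\infty$ such that $x^\dagger\in\mathcal D(B^p)$ and $\|B^p(x^\dagger-\bar x)\|_X\le E$; moreover, $x^\dagger$ is an interior point of $\mathcal D(F)$, and $x^\dagger\notin\mathcal D(B)$. For $\delta>0$ put $\alpha_*=\alpha_*(\delta):=\delta^{\frac{2(a+1)}{a+p}}$, let $y^\delta\in Y$ be any element with $\|y-y^\delta\|_Y\le\delta$, and let $x_{\alpha_*}^\delta$ be a minimizer over $\mathcal D$ of the Tikhonov functional $T^\delta_{\alpha_*}$. Then $$\|x_{\alpha_*}^\delta-x^\dagger\|_X=\mathcal O\left(\delta^{\frac{p}{a+p}}\right)\quad\text{as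 }\delta\to0,$$ that is, there are constants $K_0>0$ and $\delta_0>0$ such that for all $\delta\in(0,\delta_0]$, all $y^\delta$ with $\|y-y^\delta\|_Y\le\delta$ and all such minimizers, $\|x_{\alpha_*}^\delta-x^\dagger\|_X\le K_0\,\delta^{\frac{p}{a+p}}$.
   Context: The operator $B$ generates a Hilbert scale $\{X_\tau\}_{\tau\in\mathbb R}$ with $X_0=X$, $X_\tau=\mathcal D(B^\tau)$ and norms $\|x\|_\tau:=\|B^\tau x\|_X$, where the powers $B^\tau$ are defined by the spectral calculus (for $\tau<0$ the operator $B^\tau$ is bounded, so $\|\cdot\|_\tau$ is defined on all of $X$). For $\alpha>0$, $\delta>0$ and data $y^\delta\in Y$, the Tikhonov functional is $$T^\delta_\alpha(x):=\|F(x)-y^\delta\|_Y^2+\alpha\|B(x-\bar x)\|_X^2,\qquad x\in\mathcal D=\mathcal D(F)\cap\mathcal D(B),$$ and $x_\alpha^\delta\in\mathcal D$ denotes a minimizer of $T_\alpha^\delta$ over $\mathcal D$. *)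

(* Defs.v *)
From HB Require Import structures.
From mathcomp Require Import all_boot all_order all_algebra.
From mathcomp Require Import all_classical all_reals all_analysis.

Set Implicit Arguments.
Unset Strict Implicit.
Unset Printing Implicit Defensive.

Import Order.TTheory GRing.Theory Num.Theory.
Import numFieldNormedType.Exports.

Local Open Scope classical_set_scope.
Local Open Scope ring_scope.

(* Real Hilbert spaces.  Complex ones are covered through their realification,
   with inner product Re <x, y>: norms, weak convergence, adjoints of
   complex-linear operators and spectral measures are unchanged by it. *)
HB.mixin Record CompleteNormedModule_isHilbert (R : realType) X
    of CompleteNormedModule R X := {
  inner : X -> X -> R ;
  innerC : forall x y, inner x y = inner y x ;
  innerDl : forall x y z, inner (x + y) z = inner x z + inner y z ;
  innerZl : forall (c : R) x z, inner (c *: x) z = c * inner x z ;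
  innerxx : forall x, inner x x = `|x| ^+ 2 }.

#[short(type="hilbertType")]
HB.structure Definition Hilbert (R : realType) :=
  {X of CompleteNormedModule_isHilbert R X & CompleteNormedModule R X}.

Definition infinite_dimensional (R : realType) (X : lmodType R) : Prop :=
  ~ exists (n : nat) (e : 'I_n -> X), forall x : X,
      exists c : 'I_n -> R, x = \sum_(i < n) c i *: e i.

Definition weak_cvg (R : realType) (X : hilbertType R) (u : nat -> X) (x : X) :
    Prop :=
  forall z : X, inner (u n) z @[n --> \oo] --> inner x z.

(* A partially defined map: the values outside [dom] carry no information. *)
Record operator (X Y : Type) := Operator { dom : set X ; op_fun :> X -> Y }.

Definition weakly_seq_continuous (R : realType) (X Y : hilbertType R)
    (F : operator X Y) : Prop :=
  forall (u : nat -> X) (x : X), (forall n, dom F (u n)) -> dom F x ->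
    weak_cvg u x -> weak_cvg (fun n => F (u n)) (F x).

Section unbounded_operators.
Context (R : realType) (X : hilbertType R).
Implicit Type B : operator X X.

Definition linear_operator B : Prop :=
  dom B 0 /\
  forall (c : R) (x y : X), dom B x -> dom B y ->
    dom B (c *: x + y) /\ B (c *: x + y) = c *: B x + B y.

Definition bounded_operator B : Prop :=
  exists M : R, forall x, dom B x -> `|B x| <= M * `|x|.

(* The graph of the adjoint B^*. *)
Definition adjoint_graph B (x z : X) : Prop :=
  forall u, dom B u -> inner (B u) x = inner u z.

Definition self_adjoint B : Prop :=
  forall x z, adjoint_graph B x z <-> dom B x /\ z = B x.

(* Projection-valued measures on the Borel sets of R. *)
Record spectral_measure := SpectralMeasure {
  sproj :> set (measurableTypeR R) -> X -> X ;
  sproj_linear : forall A, measurable A -> linear (sproj A) ;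
  sproj_sym : forall A, measurable A ->
    forall x y, inner (sproj A x) y = inner x (sproj A y) ;
  sproj0 : forall x, sproj set0 x = 0 ;
  sprojT : forall x, sproj setT x = x ;
  sprojI : forall A C, measurable A -> measurable C ->
    forall x, sproj (A `&` C) x = sproj A (sproj C x) ;
  sproj_sigma_additive : forall A : nat -> set (measurableTypeR R),
    (forall n, measurable (A n)) -> trivIset setT A ->
    forall x y, series (fun n => inner (sproj (A n) x) y) @ \oo -->
      inner (sproj (\bigcup_n A n) x) y }.

End unbounded_operators.

Section spectral_calculus.
Context (R : realType) (X : hilbertType R) (E : spectral_measure X).

(* On Borel sets this is <E(A) x, x>. *)
Definition scalar_measure (x : X) (A : set (measurableTypeR R)) : \bar R :=
  (`|E A x| ^+ 2)%:E.

Lemma sproj_normE (A : set (measurableTypeR R)) x : measurable A ->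
  `|E A x| ^+ 2 = inner (E A x) x.
Proof.
by move=> mA; rewrite -innerxx -sproj_sym// -sprojI// setIid.
Qed.

Lemma scalar_measure0 x : scalar_measure x set0 = 0%E.
Proof. by rewrite /scalar_measure sproj0 normr0 expr0n. Qed.

Lemma scalar_measure_ge0 x A : (0 <= scalar_measure x A)%E.
Proof. by rewrite lee_fin exprn_ge0. Qed.

Lemma scalar_measure_semi_sigma_additive x :
  semi_sigma_additive (scalar_measure x).
Proof.
move=> A mA tA mUA; rewrite /scalar_measure sproj_normE//.
rewrite (_ : (fun n => _) =
    EFin \o series (fun n => inner (E (A n) x) x)); last first.
  apply/funext => n /=; rewrite /series/= -sumEFin.
  by apply: eq_bigr => i _; rewrite sproj_normE.
by apply: cvg_EFin; [exact: nearW|exact: sproj_sigma_additive].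
Qed.

HB.instance Definition _ (x : X) := isMeasure.Build _ _ R (scalar_measure x)
  (scalar_measure0 x) (scalar_measure_ge0 x)
  (@scalar_measure_semi_sigma_additive x).

(* The operator \int f dE, with domain {x | \int f^2 d<E x, x> < oo}.  Its
   value at x is the unique z such that <z, u> = \int f d<E x, u> for all u in
   that (dense) domain, where the signed measure <E x, u> is written by
   polarization as (<E (x+u), x+u> - <E (x-u), x-u>) / 4. *)
Definition spectral_dom (f : R -> R) : set X :=
  [set x | (\int[scalar_measure x]_(l in setT) ((f l) ^+ 2)%:E < +oo)%E].

Definition spectral_integral (f : R -> R) : operator X X :=
  Operator (spectral_dom f) (fun x =>
    xget 0 [set z : X | forall u, spectral_dom f u ->
      inner z u = 4%:R^-1 *
        (\int[scalar_measure (x + u)]_(l in setT) f l -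
         \int[scalar_measure (x - u)]_(l in setT) f l)]).

Definition is_spectral_measure_of (B : operator X X) : Prop :=
  dom B = dom (spectral_integral id) /\
  forall x, dom B x -> B x = spectral_integral id x.

(* B^t when E is the spectral measure of B.  If B is positive, then |l| = l on
   the support of E.  In general |l| is the modulus that governs the domain and
   the norm of B^t (for every branch, |l^t| = |l|^t). *)
Definition spectral_power (t : R) : operator X X :=
  spectral_integral (fun l => `|l| `^ t).

Definition scale_norm (t : R) (x : X) : R := `|spectral_power t x|.

End spectral_calculus.

Section tikhonov.
Context (R : realType) (X Y : hilbertType R).
Variables (F : operator X Y) (B : operator X X).

Definition tikhonov (alpha : R) (yd : Y) (xbar x : X) : R :=
  `|F x - yd| ^+ 2 + alpha * `|B (x - xbar)| ^+ 2.

Definition is_tikhonov_minimizer (alpha : R) (yd : Y) (xbar x : X) : Prop :=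
  (dom F `&` dom B) x /\
  forall z, (dom F `&` dom B) z ->
    tikhonov alpha yd xbar x <= tikhonov alpha yd xbar z.

End tikhonov.

(* Main.v *)
From HB Require Import structures.
Require Import Defs.
From mathcomp Require Import all_boot all_order all_algebra.
From mathcomp Require Import all_classical all_reals all_analysis.
From mathcomp Require Import measurable_realfun ring lra.
Set Implicit Arguments.
Unset Strict Implicit.
Unset Printing Implicit Defensive.
Import Order.TTheory GRing.Theory Num.Theory.
Import numFieldNormedType.Exports.
Local Open Scope classical_set_scope.
Local Open Scope ring_scope.

(* Since xdag is not in the domain of B, the Tikhonov functional is compared
   with its value at the auxiliary element xbar + v, where
   v = E({|l| <= 1/s}) (xdag - xbar) is a spectral cutoff and
   s = delta^(1/(a+p)).  xbar + v lies in dom F for small delta since xdag is an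
   interior point.  Smoothness of order p gives the bounds
   |v - (xdag - xbar)| = O(s^p), its (-a)-norm O(s^(a+p)) and
   |B v| = O(s^(p-1)), so the functional is O(delta^2) at xbar + v, hence at
   the minimizer x.  Thus z = x - xbar - v has (-a)-norm O(s^(a+p)) and
   |B z| = O(s^(p-1)), and interpolation between the orders -a and 1 yields
   |z| = O(s^p).
   Norms in the scale are integrals against the measures <E x, x>: for
   measurable f the operator \int f dE is obtained on its domain as an L^2 limit
   of simple functions, which gives |\int f dE x|^2 = \int f^2 d<E x, x>. *)

(** * Inner products and convergence in Hilbert spaces *)

Lemma sqrrD_le (R : realDomainType) (x y : R) :
  (x + y) ^+ 2 <= 2 * (x ^+ 2 + y ^+ 2).
Proof. have := sqr_ge0 (x - y); nra. Qed.

Section inner_product.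
Context (R : realType) (X : hilbertType R).
Implicit Types x y z : X.

Lemma innerDr x y z : inner x (y + z) = inner x y + inner x z.
Proof. by rewrite !(innerC x) innerDl. Qed.

Lemma innerZr c x y : inner x (c *: y) = c * inner x y.
Proof. by rewrite !(innerC x) innerZl. Qed.

Lemma innerNl x y : inner (- x) y = - inner x y.
Proof. by rewrite -scaleN1r innerZl mulN1r. Qed.

Lemma innerNr x y : inner x (- y) = - inner x y.
Proof. by rewrite innerC innerNl innerC. Qed.

Lemma inner0l x : inner 0 x = 0.
Proof. by have := innerZl 0 0 x; rewrite scale0r mul0r. Qed.

Lemma inner0r x : inner x 0 = 0.
Proof. by rewrite innerC inner0l. Qed.

Lemma inner_suml (I : Type) (r : seq I) (f : I -> X) y :
  inner (\sum_(i <- r) f i) y = \sum_(i <- r) inner (f i) y.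
Proof.
by elim: r => [|i r IH]; rewrite ?(big_nil, inner0l)// !big_cons innerDl IH.
Qed.

Lemma inner_sumr (I : Type) (r : seq I) (f : I -> X) y :
  inner y (\sum_(i <- r) f i) = \sum_(i <- r) inner y (f i).
Proof.
by rewrite innerC inner_suml; apply: eq_bigr => i _; rewrite innerC.
Qed.

Lemma normD_sqr x y : `|x + y| ^+ 2 = `|x| ^+ 2 + 2 * inner x y + `|y| ^+ 2.
Proof. by rewrite -!innerxx innerDl !innerDr (innerC y x); ring. Qed.

Lemma normB_sqr x y : `|x - y| ^+ 2 = `|x| ^+ 2 - 2 * inner x y + `|y| ^+ 2.
Proof. by rewrite normD_sqr innerNr normrN; ring. Qed.

Lemma normD_sqr_le x y : `|x + y| ^+ 2 <= 2 * (`|x| ^+ 2 + `|y| ^+ 2).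
Proof.
apply: le_trans (sqrrD_le _ _).
by rewrite ler_sqr ?nnegrE ?addr_ge0// ler_normD.
Qed.

Lemma cauchy_schwarz x y : `|inner x y| <= `|x| * `|y|.
Proof.
have pos c : 0 <= `|x| ^+ 2 + 2 * (c * inner x y) + c ^+ 2 * `|y| ^+ 2.
  have := exprn_ge0 2 (normr_ge0 (x + c *: y)).
  by rewrite normD_sqr innerZr normrZ exprMn (real_normK (num_real _)).
have [->|y0] := eqVneq y 0; first by rewrite inner0r !normr0 mulr0.
have ny : 0 < `|y| ^+ 2 by rewrite exprn_gt0// normr_gt0.
rewrite -(@ler_pXn2r _ 2) ?nnegrE ?mulr_ge0// (real_normK (num_real _)) exprMn.
have := pos (- inner x y / `|y| ^+ 2).
rewrite -(ler_pM2r ny) mul0r => H; rewrite -subr_ge0; apply: le_trans H _.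
rewrite le_eqVlt; apply/orP; left; apply/eqP; field; by rewrite normr_eq0 y0.
Qed.

Lemma cvg_innerl (u : nat -> X) x y :
  u @ \oo --> x -> inner (u n) y @[n --> \oo] --> inner x y.
Proof.
move=> ux; apply/cvgrPdist_le => e e0.
have d0 : 0 < e / (`|y| + 1) by rewrite divr_gt0// ltr_wpDl.
move/cvgrPdist_le: ux => /(_ _ d0); apply: filterS => n H.
rewrite -innerNl -innerDl (le_trans (cauchy_schwarz _ _))//.
rewrite ler_pdivlMr ?ltr_wpDl// in H; apply: le_trans H.
by rewrite ler_wpM2l// lerDl.
Qed.

(** In the application [v n] is the image of a function at squared L^2 distance [a n] from a common
    limit. Once [a n] and [a N] are below [e ^+ 2 / 8], the bound is below [e ^+ 2], so the sequence
    is Cauchy. *)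
Lemma cvg_of_sqr_bound (v : nat -> X) (a : nat -> R) :
  a @ \oo --> 0 ->
  (forall n k, `|v n - v k| ^+ 2 <= 2 * (a n + a k)) -> cvg (v @ \oo).
Proof.
move=> a0 va; apply/cauchy_cvgP/cauchy_exP => e e0.
have d0 : 0 < e ^+ 2 / 8 by rewrite divr_gt0// exprn_gt0.
move/cvgrPdist_lt: a0 => /(_ _ d0)[N _ aN].
exists (v N), N => // n Nn /=; rewrite -ball_normE/=.
rewrite -(@ltr_pXn2r _ 2) ?nnegrE ?(ltW e0)//.
apply: le_lt_trans (va _ _) _.
have := aN N (leqnn N); have := aN n Nn; rewrite /= !sub0r !normrN.
have := ler_norm (a n); have := ler_norm (a N).
lra.
Qed.

End inner_product.

(** * Integration over finite measures and approximation by simple functions *)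

Section finite_measure.
Context d (T : measurableType d) (R : realType).
Variable mu : {finite_measure set T -> \bar R}.

(** On a finite measure L^2 embeds in L^1, because |f| <= 1 + f^2 pointwise. *)
Lemma integrable_of_sqr (f : T -> R) : measurable_fun setT f ->
  (\int[mu]_l ((f l) ^+ 2)%:E < +oo)%E -> mu.-integrable setT (EFin \o f).
Proof.
move=> mf f2; apply: (@le_integrable _ _ _ mu setT measurableT _
    (fun l => 1 + ((f l) ^+ 2)%:E)%E).
- exact/measurable_EFinP.
- move=> l _ /=; rewrite lee_fin.
  rewrite (@ger0_norm _ (1 + _)) ?addr_ge0 ?sqr_ge0//.
  have := sqr_ge0 (`|f l| - 1); have := normr_ge0 (f l).
  rewrite -(real_normK (num_real (f l))); nra.
- apply: integrableD => //; first exact: finite_measure_integrable_cst.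
  apply/integrableP; split.
    by apply/measurable_EFinP; exact: measurable_funX.
  apply: le_lt_trans f2; apply: ge0_le_integral => //.
  + by apply/measurable_EFinP; apply: measurableT_comp => //; exact: measurable_funX.
  + by apply/measurable_EFinP; exact: measurable_funX.
  + by move=> l _; rewrite /= ger0_norm ?sqr_ge0.
Qed.

End finite_measure.

Lemma dominated_convergence_Rintegral d (T : measurableType d) (R : realType)
    (mu : {measure set T -> \bar R}) (u : nat -> T -> R) (f g : T -> R) :
  (forall n, measurable_fun setT (u n)) -> measurable_fun setT f ->
  (forall l, u n l @[n --> \oo] --> f l) ->
  mu.-integrable setT (EFin \o g) -> (forall n l, `|u n l| <= g l) ->
  \int[mu]_l u n l @[n --> \oo] --> \int[mu]_l f l.
Proof.
move=> mu_ mf uf ig ug.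
have [||||| intf _] := @dominated_convergence _ _ _ mu setT measurableT
    (fun n l => (u n l)%:E) (EFin \o f) (EFin \o g).
- by move=> n; exact/measurable_EFinP.
- exact/measurable_EFinP.
- by apply: aeW => l _ /=; apply: cvg_EFin; [exact: nearW|exact: uf].
- exact: ig.
- by apply: aeW => l n _; rewrite /= lee_fin.
move=> H; apply/fine_cvg; rewrite fineK//.
exact: integrable_fin_num.
Qed.

Section simple_approximation.
Import HBSimple HBNNSimple.
Context d (T : measurableType d) (R : realType) (f : T -> R).
Hypothesis mf : measurable_fun setT f.

(** The positive and negative parts are approximated from below separately. At each point one of
    them vanishes, so the difference of the approximations stays within |f|. *)
Lemma dominated_sfun_approx : exists s : nat -> {sfun T >-> R},
  (forall l, s n l @[n --> \oo] --> f l) /\ (forall n l, `|s n l| <= `|f l|).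
Proof.
pose f1 (l : T) : R := Num.max (f l) 0; pose f2 (l : T) : R := Num.max (- f l) 0.
have m1 : measurable_fun setT (EFin \o f1).
  by apply/measurable_EFinP; exact: measurable_funrpos.
have m2 : measurable_fun setT (EFin \o f2).
  by apply/measurable_EFinP; exact: measurable_funrneg.
have p1 l : setT l -> (0 <= (EFin \o f1) l)%E.
  by move=> _; rewrite lee_fin le_max lexx orbT.
have p2 l : setT l -> (0 <= (EFin \o f2) l)%E.
  by move=> _; rewrite lee_fin le_max lexx orbT.
pose s1 := nnsfun_approx measurableT m1.
pose s2 := nnsfun_approx measurableT m2.
have c1 l : s1 n l @[n --> \oo] --> f1 l.
  by have /fine_cvg := cvg_nnsfun_approx measurableT m1 p1 (I : setT l).
have c2 l : s2 n l @[n --> \oo] --> f2 l.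
  by have /fine_cvg := cvg_nnsfun_approx measurableT m2 p2 (I : setT l).
have l1 n l : s1 n l <= f1 l.
  by rewrite -lee_fin /s1 nnsfun_approxE; apply: le_approx => //; exact: p1.
have l2 n l : s2 n l <= f2 l.
  by rewrite -lee_fin /s2 nnsfun_approxE; apply: le_approx => //; exact: p2.
exists (fun n => s1 n \+ cst (-1) \* s2 n); split=> [l|n l] /=.
  under eq_fun do rewrite mulN1r.
  have -> : f l = f1 l - f2 l.
    by rewrite /f1 /f2; case: leP => ?; case: leP => ?; lra.
  exact: cvgB.
suff key (a b c : R) : a <= Num.max c 0 -> b <= Num.max (- c) 0 ->
    0 <= a -> 0 <= b -> `|a + -1 * b| <= `|c|.
  by apply: key; [exact: l1|exact: l2|exact: fun_ge0|exact: fun_ge0].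
rewrite !le_max ler_norml => /orP[] ? /orP[] ? ? ?;
  by case: (ger0P c) => ?; apply/andP; split; lra.
Qed.

End simple_approximation.

Lemma Rintegral_simple d (T : measurableType d) (R : realType)
    (mu : {finite_measure set T -> \bar R}) (I : finType) (c : I -> R)
    (A : I -> set T) : (forall i, measurable (A i)) ->
  \int[mu]_l (\sum_i c i * \1_(A i) l) = \sum_i c i * fine (mu (A i)).
Proof.
move=> mA; rewrite /Rintegral.
under eq_integral do rewrite -sumEFin.
have int1 i : mu.-integrable setT (fun l => (\1_(A i) l)%:E).
  exact: integrable_indic.
have int2 i : mu.-integrable setT (fun l => (c i * \1_(A i) l)%:E).
  by under eq_fun do rewrite EFinM; exact: integrableZl.
rewrite integral_sum//.
rewrite (eq_bigr (fun i => (c i * fine (mu (A i)))%:E)) ?sumEFin// => i _.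
under eq_integral do rewrite EFinM.
rewrite integralZl// integral_indic// setIT EFinM fineK//.
exact: fin_num_measure.
Qed.

(** * Scalar measures and the calculus of simple functions *)

Section spectral_measure_theory.
Context (R : realType) (X : hilbertType R) (E : spectral_measure X).
Implicit Types (x y z u : X) (A C : set (measurableTypeR R)) (f : R -> R).

Local Notation mu := (scalar_measure E).

Lemma scalar_measure_fin_num x : fin_num_fun (mu x).
Proof. by []. Qed.

HB.instance Definition _ x := Measure_isFinite.Build _ _ R (mu x)
  (scalar_measure_fin_num x).

Lemma sprojB A x y : measurable A -> E A (x - y) = E A x - E A y.
Proof.
by move=> mA; rewrite addrC -scaleN1r (sproj_linear _ mA) scaleN1r addrC.
Qed.

Lemma sprojD A x y : measurable A -> E A (x + y) = E A x + E A y.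
Proof. by move=> mA; rewrite -{1}(scale1r x) (sproj_linear _ mA) scale1r. Qed.

Lemma sproj_inner A C x : measurable A -> measurable C ->
  inner (E A x) (E C x) = fine (mu x (A `&` C)).
Proof.
move=> mA mC; rewrite /scalar_measure /= sproj_normE; last exact: measurableI.
by rewrite -sproj_sym// -sprojI// setIC.
Qed.

(** This is the indicator case of the polarized identity that defines [spectral_integral]. *)
Lemma sproj_polarization A x u : measurable A ->
  inner (E A x) u = 4^-1 * (fine (mu (x + u) A) - fine (mu (x - u) A)).
Proof.
move=> mA; rewrite /= sprojD// sprojB// normD_sqr normB_sqr.
by rewrite -sproj_sym// -sprojI// setIid; field.
Qed.

(** This domination of measures plays the part of a triangle inequality: it bounds integrals at
    [x + y] without appeal to additivity of the spectral integrals. *)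
Lemma scalar_measureD_le x y A : measurable A ->
  (mu (x + y)%R A <= 2%:E * (mu x A + mu y A))%E.
Proof.
by move=> mA; rewrite /scalar_measure lee_fin sprojD// normD_sqr_le.
Qed.

Lemma scalar_measureN x A : measurable A -> mu (- x) A = mu x A.
Proof.
move=> mA; rewrite /scalar_measure -scaleN1r -[-1 *: x]addr0 (sproj_linear _ mA).
by rewrite -(subrr x) sprojB// subrr addr0 scaleN1r normrN.
Qed.

Lemma scalar_measure_sproj x A C : measurable A -> measurable C ->
  mu (E C x) A = mu x (A `&` C).
Proof. by move=> mA mC; rewrite /scalar_measure sprojI. Qed.

(** A relation that asks only for some common representation of [f] and [S], with possibly
    overlapping [A i], so that differences are formed by juxtaposing representations. *)
Definition simple_pair f (S : X -> X) := exists (I : finType) (c : I -> R)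
    (A : I -> set (measurableTypeR R)), [/\ forall i, measurable (A i),
  f = (fun l => \sum_i c i * \1_(A i) l) &
  S = (fun x => \sum_i c i *: E (A i) x)].

Lemma simple_pairB f g S T : simple_pair f S -> simple_pair g T ->
  simple_pair (f \- g) (fun x => S x - T x).
Proof.
move=> [I [c [A [mA -> ->]]]] [J [e [C [mC -> ->]]]].
exists (I + J)%type, (fun k => match k with inl i => c i | inr j => - e j end).
exists (fun k => match k with inl i => A i | inr j => C j end); split.
- by case.
- by apply/funext => l; rewrite big_sumType/= -sumrN; congr +%R;
    apply: eq_bigr => i _; rewrite mulNr.
- by apply/funext => x; rewrite big_sumType/= -sumrN; congr +%R;
    apply: eq_bigr => i _; rewrite scaleNr.
Qed.

(** The isometry for simple functions: since <E(A) x, E(C) x> is the mass of the intersection of A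
    and C, both sides are the same double sum over pairs of indices. *)
Lemma simple_pair_norm f S x : simple_pair f S ->
  `|S x| ^+ 2 = \int[mu x]_l (f l ^+ 2).
Proof.
move=> [I [c [A [mA -> ->]]]].
under eq_Rintegral => l _.
  rewrite expr2 big_distrlr/= pair_big/=.
  under eq_bigr do rewrite mulrACA -[_ * \1_ _ l]/((_ \* _) l) -indicI.
  over.
rewrite /= (Rintegral_simple (mu x) (fun k : I * I => c k.1 * c k.2)
  (A := fun k => A k.1 `&` A k.2)); last by move=> k; exact: measurableI.
rewrite -innerxx inner_suml -(pair_big xpredT xpredT
  (fun i j => c i * c j * fine (mu x (A i `&` A j))))/=.
apply: eq_bigr => i _; rewrite inner_sumr; apply: eq_bigr => j _.
by rewrite innerZl innerZr sproj_inner// mulrA.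
Qed.

Lemma simple_pair_weak f S x u : simple_pair f S ->
  inner (S x) u = 4^-1 * (\int[mu (x + u)]_l f l - \int[mu (x - u)]_l f l).
Proof.
move=> [I [c [A [mA -> ->]]]]; rewrite !Rintegral_simple// -sumrB mulr_sumr.
rewrite inner_suml; apply: eq_bigr => i _.
by rewrite innerZl sproj_polarization//; ring.
Qed.

Import HBSimple.

Lemma sfun_simple_pair (s : {sfun measurableTypeR R >-> R}) :
  exists S, simple_pair s S.
Proof.
pose r : seq R := finmap.enum_fset (fset_set (range s)).
eexists; exists 'I_(size r), (fun i : 'I_(size r) => r`_i),
  (fun i : 'I_(size r) => s @^-1` [set r`_i]).
split=> //; apply/funext => l; exact: fimfunEord.
Qed.

End spectral_measure_theory.

(** * Domains of spectral integrals *)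

Section spectral_integrals.
Context (R : realType) (X : hilbertType R) (E : spectral_measure X).
Implicit Types (x y z u : X) (A C : set (measurableTypeR R)).
Implicit Types f : measurableTypeR R -> R.

Local Notation mu := (scalar_measure E).

Lemma integral_scalar_measureD_le f x y : measurable_fun setT f ->
  (forall l, 0 <= f l) ->
  (\int[mu (x + y)%R]_l (f l)%:E <=
    2%:E * (\int[mu x]_l (f l)%:E + \int[mu y]_l (f l)%:E))%E.
Proof.
move=> mf f0; have mF : measurable_fun setT (EFin \o f) by exact/measurable_EFinP.
have f0' l : setT l -> (0 <= (f l)%:E)%E by rewrite lee_fin.
rewrite -(ge0_integral_measure_add (mu x) (mu y) measurableT f0' mF).
pose two : {nonneg R} := NngNum (ler0n R 2).
rewrite -(ge0_integral_mscale (measure_add (mu x) (mu y)) measurableT two mF f0').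
apply: ge0_le_measure_integral => // A mA.
have := scalar_measureD_le E x y mA.
by rewrite -(measure_addE (mu x) (mu y)).
Qed.

Lemma integral_scalar_measureN f x :
  (\int[mu (- x)%R]_l (f l)%:E = \int[mu x]_l (f l)%:E)%E.
Proof.
by apply: eq_measure_integral => A mA _; exact: scalar_measureN.
Qed.

(** The scalar measure of [E C x] is the restriction of that of [x]: it has no mass off [C] and
    agrees with it on measurable subsets of [C]. *)
Lemma integral_sproj f x C : measurable C -> measurable_fun setT f ->
  (forall l, 0 <= f l) ->
  (\int[mu (E C x)]_l (f l)%:E = \int[mu x]_(l in C) (f l)%:E)%E.
Proof.
move=> mC mf f0; have mF : measurable_fun setT (EFin \o f) by exact/measurable_EFinP.
rewrite (@ge0_negligible_integral _ _ _ _ setT (~` C))//.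
- rewrite setTD setCK; apply: eq_measure_integral => A mA AC.
  by rewrite -[in RHS](setIidl AC); exact: scalar_measure_sproj.
- exact: measurableC.
- by move=> l _; rewrite lee_fin.
- rewrite -(measure0 (mu x)) -(setICl C).
  by apply: scalar_measure_sproj => //; exact: measurableC.
Qed.

Lemma spectral_dom_integrable f x : measurable_fun setT f ->
  spectral_dom E f x -> (mu x).-integrable setT (EFin \o f).
Proof. by move=> mf; exact: integrable_of_sqr. Qed.

Lemma spectral_domD f x y : measurable_fun setT f ->
  spectral_dom E f x -> spectral_dom E f y -> spectral_dom E f (x + y).
Proof.
move=> mf fx fy; rewrite /spectral_dom/=.
apply: le_lt_trans (integral_scalar_measureD_le x y _ _) _.
- exact: measurable_funX.
- by move=> l; exact: sqr_ge0.
- by rewrite lte_mul_pinfty// lte_add_pinfty.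
Qed.

Lemma spectral_domN f x : spectral_dom E f x -> spectral_dom E f (- x).
Proof. by rewrite /spectral_dom/= integral_scalar_measureN. Qed.

Lemma spectral_domB f x y : measurable_fun setT f ->
  spectral_dom E f x -> spectral_dom E f y -> spectral_dom E f (x - y).
Proof. by move=> mf fx fy; apply: spectral_domD => //; exact: spectral_domN. Qed.

(** With [f] the identity, this produces the elements of [dom B] used for the spectral gap and for
    the comparison element. *)
Lemma spectral_dom_bounded f x (M : R) C : measurable C ->
  measurable_fun setT f -> (forall l, C l -> `|f l| <= M) ->
  spectral_dom E f (E C x).
Proof.
move=> mC mf fM; rewrite /spectral_dom/= integral_sproj//; last first.
- by move=> l; exact: sqr_ge0.
- exact: measurable_funX.
apply: (@le_lt_trans _ _ (\int[mu x]_(l in C) (M ^+ 2)%:E)%E).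
  apply: ge0_le_integral => //.
  - by move=> l _; rewrite lee_fin sqr_ge0.
  - by apply/measurable_EFinP; apply: measurable_funTS; exact: measurable_funX.
  - move=> l Cl; rewrite lee_fin -(real_normK (num_real (f l))).
    by rewrite lerXn2r ?nnegrE// ?fM// (le_trans _ (fM _ Cl)).
rewrite integral_cst//.
by rewrite /scalar_measure -EFinM ltry.
Qed.

(* The bounded vectors [E [set l | `|f l| <= n] d] are dense in the domain. *)
Lemma spectral_dom_dense f d : measurable_fun setT f ->
  (forall u, spectral_dom E f u -> inner d u = 0) -> d = 0.
Proof.
move=> mf H.
pose A n : set (measurableTypeR R) := [set l | `|f l| <= n%:R].
have mA n : measurable (A n).
  have mn : measurable_fun setT (fun l => `|f l|) by exact: measurableT_comp.
  rewrite /A (_ : [set _ | _] = setT `&` (fun l => `|f l|) @^-1` [set` `]-oo, n%:R]]).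
    exact: mn.
  by rewrite setTI; apply/seteqP; split => l /=; rewrite in_itv.
have A0 n : mu d (A n) = 0%E.
  rewrite /scalar_measure sproj_normE// innerC H//.
  by apply: (@spectral_dom_bounded _ _ n%:R).
have AT : \bigcup_n A n = setT.
  apply/seteqP; split=> // l _; exists (Num.bound `|f l|) => //=.
  by apply/ltW/archi_boundP.
have : mu d \o A @ \oo --> mu d (\bigcup_n A n).
  apply: nondecreasing_cvg_mu => //; first exact: bigcup_measurable.
  move=> m n mn; apply/subsetPset => l /= /le_trans; apply.
  by rewrite ler_nat.
rewrite AT (_ : _ \o _ = cst 0%E); last by apply/funext => n /=; exact: A0.
move/cvg_lim => /(_ (@ereal_hausdorff _)); rewrite lim_cst// => /esym.
by rewrite /scalar_measure sprojT => -[] /eqP; rewrite sqrf_eq0 normr_eq0 => /eqP.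
Qed.

End spectral_integrals.

(** * Existence and norm of spectral integrals *)

Section spectral_norm.
Context (R : realType) (X : hilbertType R) (E : spectral_measure X).
Implicit Types (x y z u : X) (A C : set (measurableTypeR R)).
Variable f : measurableTypeR R -> R.
Hypothesis mf : measurable_fun setT f.
Import HBSimple.

Local Notation mu := (scalar_measure E).

(** [z] is the limit of the simple integrals [S n x], and both conclusions are limits of their
    simple counterparts by dominated convergence. They concern one [z], which is later identified
    with the value of [spectral_integral]. *)
Lemma spectral_integral_exists x : spectral_dom E f x ->
  exists z, (forall u, spectral_dom E f u -> inner z u =
      4^-1 * (\int[mu (x + u)]_l f l - \int[mu (x - u)]_l f l)) /\
    `|z| ^+ 2 = \int[mu x]_l (f l ^+ 2).
Proof.
move=> fx; have [s [sf sle]] := dominated_sfun_approx mf.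
have /choice[S sS] := fun n => sfun_simple_pair E (s n).
have mf2 : measurable_fun setT (fun l => f l ^+ 2) by exact: measurable_funX.
have if2 : (mu x).-integrable setT (EFin \o (fun l => f l ^+ 2)).
  apply/integrableP; split; first exact/measurable_EFinP.
  apply: le_lt_trans fx; apply: ge0_le_integral => //.
  - by apply/measurable_EFinP; exact: measurableT_comp.
  - exact/measurable_EFinP.
  - by move=> l _; rewrite /= ger0_norm// sqr_ge0.
have if4 (c : R) : (mu x).-integrable setT (EFin \o (fun l => c * f l ^+ 2)).
  by apply: eq_integrable (integrableZl measurableT c if2).
have ms n : measurable_fun setT (s n) by [].
pose a n := \int[mu x]_l ((s n l - f l) ^+ 2).
have md n : measurable_fun setT (fun l => (s n l - f l) ^+ 2).
  by apply: measurable_funX; exact: measurable_funB.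
(* Since |s n - f| <= 2 |f|, the function 4 f^2 is a majorant independent of [n]; it also dominates
   (s n - s k)^2. *)
have dle n l : `|(s n l - f l) ^+ 2| <= 4 * f l ^+ 2.
  rewrite normrX; have := ler_normB (s n l) (f l); have := sle n l.
  have := normr_ge0 (s n l - f l).
  rewrite -(real_normK (num_real (f l))); nra.
have f4 l : `|4 * f l ^+ 2| = 4 * f l ^+ 2.
  by rewrite ger0_norm//; apply: mulr_ge0 => //; exact: sqr_ge0.
have ia n : (mu x).-integrable setT (EFin \o (fun l => (s n l - f l) ^+ 2)).
  apply: le_integrable (if4 4) => //; first exact/measurable_EFinP.
  by move=> l _; rewrite [X in (_ <= X)%E]/= f4 lee_fin; exact: dle.
have a0 : a @ \oo --> 0.
  rewrite [X in _ --> X](_ : 0 = \int[mu x]_l 0); last first.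
    by rewrite Rintegral_cst// mul0r.
  apply: dominated_convergence_Rintegral (if4 4) dle => // l. 
  rewrite (_ : 0 = (f l - f l) ^+ 2); last by rewrite subrr expr0n.
  rewrite expr2; under eq_fun do rewrite expr2.
  by apply: cvgM; apply: cvgB => //; exact: cvg_cst.
(* The isometry is applied to the simple function s n - s k, and [f] is inserted between the two
   terms. *)
have Sle n k : `|S n x - S k x| ^+ 2 <= 2 * (a n + a k).
  rewrite (simple_pair_norm x (simple_pairB (sS n) (sS k))) /a.
  rewrite -RintegralD// -RintegralZl//; last first.
    by apply: eq_integrable (integrableD measurableT (ia n) (ia k)).
  apply: le_Rintegral => //.
  - apply: le_integrable (if4 4) => //.
      apply/measurable_EFinP; apply: measurable_funX; exact: measurable_funB.
    move=> l _; rewrite [X in (_ <= X)%E]/= f4 lee_fin.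
    rewrite normrX; have := ler_normB (s n l) (s k l).
    have := sle n l; have := sle k l; have := normr_ge0 (s n l - s k l).
    rewrite -(real_normK (num_real (f l))); nra.
  - apply: eq_integrable (integrableZl measurableT 2 (integrableD measurableT (ia n) (ia k))) => //.
  - move=> l _; have := sqrrD_le (s n l - f l) (f l - s k l).
    rewrite [_ - f l + _](_ : _ = s n l - s k l); last by ring.
    by rewrite -(sqrrN (f l - s k l)) opprB.
have /cvg_ex[z Sz] := cvg_of_sqr_bound a0 Sle.
exists z; split=> [u fu|].
  have Szu : inner (S n x) u @[n --> \oo] --> inner z u by exact: cvg_innerl.
  apply: (cvg_unique _ Szu) => //.
  have -> : (fun n => inner (S n x) u) = (fun n => 4^-1 *
      (\int[mu (x + u)]_l s n l - \int[mu (x - u)]_l s n l)).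
    by apply/funext => n; exact: simple_pair_weak.
  apply: cvgM; first exact: cvg_cst.
  apply: cvgB; apply: dominated_convergence_Rintegral (fun n l => sle n l) => //.
  - by apply/integrable_norm/spectral_dom_integrable => //; exact: spectral_domD.
  - by apply/integrable_norm/spectral_dom_integrable => //; exact: spectral_domB.
have n1 : `|S n x| ^+ 2 @[n --> \oo] --> `|z| ^+ 2.
  by rewrite expr2; under eq_fun do rewrite expr2; apply: cvgM; exact: cvg_norm.
apply: (cvg_unique _ n1) => //.
have -> : (fun n => `|S n x| ^+ 2) = (fun n => \int[mu x]_l (s n l ^+ 2)).
  by apply/funext => n; exact: simple_pair_norm.
apply: dominated_convergence_Rintegral if2 _ => //.
- by move=> n; exact: measurable_funX.
- by move=> l; rewrite expr2; under eq_fun do rewrite expr2; apply: cvgM.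
- move=> n l; rewrite normrX -(real_normK (num_real (f l))).
  by rewrite lerXn2r ?nnegrE.
Qed.

(** Two solutions of the defining identity differ by a vector orthogonal to the dense domain. Hence
    [xget] returns the vector already constructed, whose norm is known. *)
Lemma spectral_integral_norm x : spectral_dom E f x ->
  ((`|spectral_integral E f x| ^+ 2)%:E = \int[mu x]_l ((f l) ^+ 2)%:E)%E.
Proof.
move=> fx; have [z [zP zn]] := spectral_integral_exists fx.
suff -> : spectral_integral E f x = z.
  rewrite zn fineK// ge0_fin_numE//; apply: integral_ge0 => l _.
  by rewrite lee_fin sqr_ge0.
apply: xget_unique => [//|z' z'P].
apply/eqP; rewrite -subr_eq0; apply/eqP.
apply: (@spectral_dom_dense _ _ E _ _ mf) => u fu.
rewrite innerDl innerNl; apply/eqP; rewrite subr_eq0; apply/eqP.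
exact: etrans (z'P u fu) (esym (zP u fu)).
Qed.

End spectral_norm.

(** * The Hilbert scale generated by B *)

Lemma ler_powRN (R : realType) (q c t : R) :
  0 <= q -> 0 < c -> c <= t -> t `^ (- q) <= c `^ (- q).
Proof.
move=> q0 c0 ct; have t0 := lt_le_trans c0 ct.
rewrite !powRN lef_pV2 ?posrE ?powR_gt0//.
by apply: ge0_ler_powR; rewrite ?nnegrE//; exact: ltW.
Qed.

Section hilbert_scale.
Context (R : realType) (X : hilbertType R) (E : spectral_measure X).
Variables (B : operator X X) (m : R).
Hypotheses (m_gt0 : 0 < m) (BE : is_spectral_measure_of E B).
Hypothesis B_below : forall x, dom B x -> m * `|x| <= `|B x|.
Implicit Types (x y z u v w : X) (f g : measurableTypeR R -> R).

Local Notation mu := (scalar_measure E).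
Local Notation absset r := [set l : measurableTypeR R | `|l| <= r].

Lemma measurable_absset (r : R) : measurable (absset r).
Proof.
rewrite (_ : absset r = `[- r, r]%classic); first exact: measurable_itv.
by apply/seteqP; split => l /=; rewrite in_itv /= ler_norml.
Qed.

Lemma measurable_norm_powR (t : R) :
  measurable_fun setT (fun l : measurableTypeR R => `|l| `^ t).
Proof.
apply: (measurableT_comp (measurable_powR t)).
exact: normr_measurable.
Qed.

Lemma measurable_sqr : measurable_fun setT (fun l : measurableTypeR R => l ^+ 2).
Proof. by apply: (@measurable_funX _ _ _ _ id); exact: measurable_id. Qed.

(** The difference [d] of the two sides has zero scalar measure on [C] and on its complement, hence
    |d|^2 = 0. This turns weak additivity into an identity of vectors. *)
Lemma sproj_setC x C : measurable C -> E (~` C) x = x - E C x.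
Proof.
move=> mC; have mC' : measurable (~` C) by exact: measurableC.
apply/esym/eqP; rewrite -subr_eq0 -normr_eq0 -sqrf_eq0.
set d := _ - _.
have d1 : mu d C = 0%E.
  rewrite /scalar_measure /d !sprojB// -!sprojI// setIid setICr sproj0.
  by rewrite subrr subr0 normr0 expr0n.
have d2 : mu d (~` C) = 0%E.
  rewrite /scalar_measure /d !sprojB// -!sprojI// setIid setICl sproj0.
  by rewrite subr0 subrr normr0 expr0n.
have : mu d (C `|` ~` C) = 0%E.
  transitivity (mu d C + mu d (~` C))%E; last by rewrite d1 d2 adde0.
  by apply: measureU => //; rewrite setICr.
by rewrite setUCr /scalar_measure sprojT => -[->].
Qed.

Lemma domB x : dom B x = spectral_dom E id x.
Proof. by case: BE => ->. Qed.

Lemma B_norm x : dom B x ->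
  ((`|B x| ^+ 2)%:E = \int[mu x]_l (l ^+ 2)%:E)%E.
Proof.
move=> Bx; rewrite (BE.2 _ Bx) spectral_integral_norm//.
by rewrite -domB.
Qed.

Lemma scale_norm_sqr (t : R) x : dom (spectral_power E t) x ->
  ((scale_norm E t x ^+ 2)%:E = \int[mu x]_l ((`|l| `^ t) ^+ 2)%:E)%E.
Proof.
by move=> xt; apply: spectral_integral_norm xt; exact: measurable_norm_powR.
Qed.

(** For v = E({|l| <= m/2}) x one has m |v| <= |B v| <= (m/2) |v|, which forces v = 0. The radius
    m/2 makes the two bounds incompatible for nonzero v. *)
Lemma spectral_gap x : mu x (absset (m / 2)) = 0%E.
Proof.
set C := absset (m / 2); have mC : measurable C := measurable_absset (m / 2).
have dv : dom B (E C x).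
  by rewrite domB; apply: (@spectral_dom_bounded _ _ _ _ _ (m / 2)).
have /= Bv : `|B (E C x)| ^+ 2 <= (m / 2) ^+ 2 * `|E C x| ^+ 2.
  rewrite -lee_fin B_norm// integral_sproj//; last first.
  - by move=> l; exact: sqr_ge0.
  apply: (@le_trans _ _ (\int[mu x]_(l in C) ((m / 2) ^+ 2)%:E)%E).
    apply: ge0_le_integral => //.
    - by move=> l _; rewrite lee_fin sqr_ge0.
    - by apply/measurable_EFinP; apply: measurable_funTS; exact: measurable_sqr.
    - move=> l Cl; rewrite lee_fin -(real_normK (num_real l)).
      by rewrite lerXn2r ?nnegrE// (le_trans _ Cl).
  by rewrite integral_cst// /scalar_measure -EFinM.
have := B_below dv; rewrite -(@ler_pXn2r _ 2) ?nnegrE ?mulr_ge0 ?(ltW m_gt0)//.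
rewrite exprMn => /le_trans/(_ Bv).
rewrite /scalar_measure; have := sqr_ge0 `|E C x|.
move: (`|E C x| ^+ 2) => t t0 H; congr EFin; apply/eqP.
have m2 : 0 < m ^+ 2 by rewrite exprn_gt0.
by rewrite eq_le t0 andbT; nra.
Qed.

(** Integrands need only be compared for |l| > m/2. This keeps l = 0 away, where a negative power
    takes the value 0 by convention and the comparisons can fail. *)
Lemma le_integral_gap x (C : set (measurableTypeR R)) f g (c : R) : measurable C ->
  measurable_fun setT f -> measurable_fun setT g -> 0 <= c ->
  (forall l, 0 <= f l) -> (forall l, 0 <= g l) ->
  (forall l, C l -> m / 2 < `|l| -> f l <= c * g l) ->
  (\int[mu x]_(l in C) (f l)%:E <= c%:E * \int[mu x]_l (g l)%:E)%E.
Proof.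
move=> mC mf mg c0 f0 g0 fg.
pose A := absset (m / 2); have mA : measurable A := measurable_absset (m / 2).
have mF : measurable_fun setT (EFin \o f) by exact/measurable_EFinP.
have mG : measurable_fun setT (EFin \o g) by exact/measurable_EFinP.
have mcG : measurable_fun setT (fun l => c%:E * (g l)%:E)%E.
  by under eq_fun do rewrite -EFinM; apply/measurable_EFinP; exact: measurable_funM.
rewrite -ge0_integralZl_EFin//; last by move=> l _; rewrite lee_fin.
rewrite (ge0_negligible_integral mA mC _ _ (spectral_gap x)); last 2 first.
- exact: measurable_funTS.
- by move=> l _; rewrite lee_fin.
have mD : measurable (C `\` A) by exact: measurableD.
apply: (@le_trans _ _ (\int[mu x]_(l in C `\` A) (c%:E * (g l)%:E))%E).
  apply: ge0_le_integral => //.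
  - by move=> l _; rewrite lee_fin.
  - exact: measurable_funTS.
  - exact: measurable_funTS.
  - move=> l [Cl /negP]; rewrite -ltNge => Al.
    by rewrite -EFinM lee_fin fg.
apply: ge0_subset_integral => //.
by move=> l _; rewrite mule_ge0 ?lee_fin.
Qed.

Lemma dom_spectral_powerN (a : R) x : 0 < a -> dom (spectral_power E (- a)) x.
Proof.
move=> a0; rewrite /= /spectral_dom /=.
apply: (@le_lt_trans _ _ ((((m / 2) `^ (- a)) ^+ 2)%:E * \int[mu x]_l 1%:E)%E).
  apply: le_integral_gap => //.
  - by apply: measurable_funX; exact: measurable_norm_powR.
  - by rewrite sqr_ge0.
  - move=> l _ ml; rewrite mulr1 lerXn2r ?nnegrE ?powR_ge0//.
    by apply: ler_powRN; [exact: ltW|rewrite divr_gt0|exact: ltW].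
by rewrite integral_cst// /scalar_measure -!EFinM ltry.
Qed.

(** Write |l|^p = |l|^(p-1) |l|; the first factor is bounded off the gap. This places [xbar], and so
    xdag - xbar, in the domain of B^p. *)
Lemma sub_dom_spectral_power (p : R) x : p <= 1 -> dom B x ->
  dom (spectral_power E p) x.
Proof.
move=> p1; rewrite domB /= /spectral_dom /= => Bx.
apply: (@le_lt_trans _ _ (((1 + ((m / 2) `^ (p - 1)) ^+ 2))%:E *
    \int[mu x]_l (l ^+ 2)%:E)%E).
  apply: le_integral_gap => //.
  - by apply: measurable_funX; exact: measurable_norm_powR.
  - by rewrite addr_ge0// sqr_ge0.
  - by move=> l; rewrite sqr_ge0.
  - move=> l _ ml; have h0 : 0 < m / 2 by rewrite divr_gt0.
    have l0 := lt_trans h0 ml.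
    apply: (@le_trans _ _ (((m / 2) `^ (p - 1)) ^+ 2 * l ^+ 2)); last first.
      by rewrite ler_wpM2r ?sqr_ge0// lerDr.
    rewrite -(real_normK (num_real l)) -exprMn lerXn2r ?nnegrE ?mulr_ge0 ?powR_ge0//.
    have -> : `|l| `^ p = `|l| `^ (p - 1) * `|l|.
      by rewrite -{3}[`|l|]powRr1// -powRD ?subrK// (gt_eqF l0) implybT.
    rewrite ler_wpM2r// -(opprB 1 p).
    by apply: ler_powRN; rewrite ?subr_ge0// ltW.
by apply: lte_mul_pinfty => //; rewrite lee_fin addr_ge0// sqr_ge0.
Qed.

Lemma scale_normN_sqrB_le (a : R) x y : 0 < a ->
  scale_norm E (- a) (x - y) ^+ 2 <=
    2 * (scale_norm E (- a) x ^+ 2 + scale_norm E (- a) y ^+ 2).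
Proof.
move=> a0; rewrite -lee_fin (EFinM 2) (EFinD (_ ^+ 2)) !scale_norm_sqr;
  try exact: dom_spectral_powerN.
apply: le_trans (integral_scalar_measureD_le E x (- y) _ _) _.
- by apply: measurable_funX; exact: measurable_norm_powR.
- by move=> l; rewrite sqr_ge0.
- by rewrite integral_scalar_measureN.
Qed.

Lemma domBB x y : dom B x -> dom B y -> dom B (x - y).
Proof. by rewrite !domB; exact: spectral_domB. Qed.

Lemma normB_sqrB_le x y : dom B x -> dom B y ->
  `|B (x - y)| ^+ 2 <= 2 * (`|B x| ^+ 2 + `|B y| ^+ 2).
Proof.
move=> Bx By; rewrite -lee_fin (EFinM 2) (EFinD (_ ^+ 2)) !B_norm//; last exact: domBB.
apply: le_trans (integral_scalar_measureD_le E x (- y) _ _) _.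
- exact: measurable_sqr.
- by move=> l; rewrite sqr_ge0.
- by rewrite integral_scalar_measureN.
Qed.

(* Pointwise, [1 <= (s l) ^ (- 2 a)] if [s l <= 1], and
    [1 <= (s l) ^ 2] otherwise. *)
Lemma interpolation (a s : R) z : 0 < a -> 0 < s -> dom B z ->
  `|z| ^+ 2 <= (s `^ (- a)) ^+ 2 * scale_norm E (- a) z ^+ 2
    + s ^+ 2 * `|B z| ^+ 2.
Proof.
move=> a0 s0 Bz; rewrite -lee_fin EFinD !(EFinM (_ ^+ 2) (_ ^+ 2)) B_norm//.
rewrite scale_norm_sqr; last exact: dom_spectral_powerN.
have mp : measurable_fun setT (fun l : measurableTypeR R => (`|l| `^ (- a)) ^+ 2).
  by apply: measurable_funX; exact: measurable_norm_powR.
have mi : measurable_fun setT (fun l : measurableTypeR R => l ^+ 2).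
  exact: measurable_sqr.
rewrite -!ge0_integralZl_EFin ?sqr_ge0//;
  try by [move=> l _; rewrite lee_fin sqr_ge0 | exact/measurable_EFinP].
rewrite -ge0_integralD//; try (by move=> l _; rewrite -EFinM lee_fin mulr_ge0 ?sqr_ge0);
  try (by under eq_fun do rewrite -EFinM; apply/measurable_EFinP; exact: measurable_funM).
have := @le_integral_gap z setT (fun=> 1) (fun l => (s `^ (- a)) ^+ 2 *
  (`|l| `^ (- a)) ^+ 2 + s ^+ 2 * l ^+ 2) 1 measurableT.
rewrite integral_cst// mul1e mul1e /= /scalar_measure sprojT; apply => //.
- by apply: measurable_funD; exact: measurable_funM.
- by move=> l; rewrite addr_ge0// mulr_ge0 ?sqr_ge0.
- move=> l _ ml; rewrite mul1r.
  have l0 : 0 < `|l| by apply: lt_trans ml; rewrite divr_gt0.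
  rewrite -(real_normK (num_real l)) -!exprMn -powRM ?(ltW s0)//.
  have [sl|/ltW sl] := leP (s * `|l|) 1.
    rewrite ler_wpDr ?sqr_ge0// exprn_ege1// -(powRr0 (s * `|l|)).
    by apply: ger_powR; rewrite ?mulr_gt0// oppr_le0 ltW.
  by rewrite ler_wpDl ?sqr_ge0// exprn_ege1.
Qed.

(** Take v = E(A) w with A = {s |l| <= 1}, so that v - w lives where s |l| > 1 and v where s |l| <=
    1. On each region the integrand is compared with the weight |l|^(2p), at the price of a power of
    s. *)
Lemma spectral_cutoff (a p s rho : R) w : 0 < a -> 0 < p -> p < 1 -> 0 < s ->
  dom (spectral_power E p) w -> `|spectral_power E p w| <= rho ->
  exists v, [/\ dom B v, `|v - w| <= s `^ p * rho,
    scale_norm E (- a) (v - w) <= s `^ (a + p) * rho &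
    `|B v| <= s `^ (p - 1) * rho].
Proof.
move=> a0 p0 p1 s0 dw nw.
have rho0 : 0 <= rho by exact: le_trans nw.
pose A : set (measurableTypeR R) := absset s^-1.
have mA : measurable A by exact: measurable_absset.
have mAc : measurable (~` A) by exact: measurableC.
have mp t : measurable_fun setT (fun l : measurableTypeR R => (`|l| `^ t) ^+ 2).
  by apply: measurable_funX; exact: measurable_norm_powR.
have sAc l : (~` A) l -> 1 <= s * `|l|.
  by move=> /negP; rewrite -ltNge => /ltW; rewrite -div1r ler_pdivrMr// mulrC.
have sA l : A l -> s * `|l| <= 1 by rewrite /A/= -div1r ler_pdivlMr// mulrC.
have vw : E A w - w = - E (~` A) w by rewrite sproj_setC// opprB.
have nwE : (\int[mu w]_l ((`|l| `^ p) ^+ 2)%:E <= (rho ^+ 2)%:E)%E.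
  by rewrite -scale_norm_sqr// lee_fin lerXn2r ?nnegrE// normr_ge0.
(* The three bounds reduce to integral inequalities against this weight, whose integral is at most
   rho^2. *)
have sqr_le (q b : R) : 0 <= q -> 0 <= b -> ((q ^+ 2)%:E <= (b ^+ 2)%:E *
   \int[mu w]_l ((`|l| `^ p) ^+ 2)%:E)%E -> q <= b * rho.
  move=> q0 b0 /le_trans H; rewrite -(@ler_pXn2r _ 2) ?nnegrE ?mulr_ge0//.
  rewrite exprMn -lee_fin (EFinM (_ ^+ 2) (_ ^+ 2)); apply: H.
  by apply: lee_wpmul2l nwE; rewrite lee_fin sqr_ge0.
have gap0 l : m / 2 < `|l| -> 0 < `|l|.
  by apply: lt_trans; rewrite divr_gt0.
have sq0 (h : R -> R) : forall l, 0 <= h l ^+ 2 by move=> l; exact: sqr_ge0.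
have EAd : dom B (E A w).
  by rewrite domB; apply: (@spectral_dom_bounded _ _ _ _ _ s^-1).
exists (E A w); split=> //.
- apply: sqr_le; [exact: normr_ge0|exact: powR_ge0|].
  rewrite vw normrN.
  have -> : ((`|E (~` A) w| ^+ 2)%:E = \int[mu w]_(l in ~` A) 1%:E)%E.
    by rewrite (integral_cst (mu w) mAc 1) mul1e.
  apply: le_integral_gap => // l /sAc sl /gap0 l0.
  rewrite -exprMn -powRM ?(ltW s0)// exprn_ege1// -(powRr0 (s * `|l|)).
  by apply: ler_powR => //; exact: ltW.
- apply: sqr_le; [exact: normr_ge0|exact: powR_ge0|].
  rewrite scale_norm_sqr; last exact: dom_spectral_powerN.
  rewrite vw integral_scalar_measureN integral_sproj//.
  apply: le_integral_gap => // l /sAc sl /gap0 l0.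
  rewrite -exprMn lerXn2r ?nnegrE ?mulr_ge0 ?powR_ge0//.
  rewrite powRD ?(gt_eqF s0) ?implybT// -mulrA -powRM ?(ltW s0)//.
  (* It remains to use (s |l|)^(-a) <= (s |l|)^p, valid as s |l| >= 1. *)
  have -> : `|l| `^ (- a) = s `^ a * (s * `|l|) `^ (- a).
    have ss : s `^ a * s `^ (- a) = 1.
      by rewrite powRN mulfV// gt_eqF// powR_gt0.
    by rewrite powRM ?(ltW s0)// mulrA ss mul1r.
  rewrite ler_wpM2l ?powR_ge0//; apply: ler_powR => //.
  by rewrite (@le_trans _ _ 0) ?oppr_le0 ?ltW.
- apply: sqr_le; [exact: normr_ge0|exact: powR_ge0|].
  rewrite B_norm// integral_sproj//; last by move=> l; exact: sqr_ge0.
  apply: le_integral_gap => // [l|l /sA sl /gap0 l0]; first exact: sqr_ge0.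
  (* After multiplication by s the claim is s |l| <= (s |l|)^p, true for s |l| <= 1 and p < 1. *)
  rewrite -exprMn -(real_normK (num_real l)) lerXn2r ?nnegrE ?mulr_ge0 ?powR_ge0//.
  rewrite powRD ?(gt_eqF s0) ?implybT// mulrAC -powRM ?(ltW s0)//.
  rewrite powR_inv1 ?(ltW s0)// ler_pdivlMr// mulrC.
  by apply: ger1_powR; rewrite ?mulr_gt0// ltW.
Qed.

End hilbert_scale.

(** * The convergence rate *)

Theorem theorem1 (R : realType) (X Y : hilbertType R)
  (hX : infinite_dimensional X) (hY : infinite_dimensional Y)
  (B : operator X X)
  (B_dense : dense (dom B))
  (B_linear : linear_operator B)
  (B_unbounded : ~ bounded_operator B)
  (B_selfadj : self_adjoint B)
  (m : R) (m_gt0 : 0 < m)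
  (B_below : forall x, dom B x -> m * `|x| <= `|B x|)
  (E : spectral_measure X) (BE : is_spectral_measure_of E B)
  (F : operator X Y)
  (F_convex : convex_set (dom F))
  (F_closed : closed (dom F))
  (F_wcont : weakly_seq_continuous F)
  (D_neq0 : dom F `&` dom B !=set0)
  (y : Y) (xdag : X) (xdagF : dom F xdag) (Fxdag : F xdag = y)
  (xbar : X) (xbarD : (dom F `&` dom B) xbar)
  (a : R) (a_gt0 : 0 < a)
  (c_a C_a : R) (c_a_gt0 : 0 < c_a) (cC_a : c_a <= C_a)
  (F_struct : forall x, (dom F `&` dom B) x ->
     c_a * scale_norm E (- a) (x - xdag) <= `|F x - F xdag| /\
     `|F x - F xdag| <= C_a * scale_norm E (- a) (x - xdag))
  (p : R) (p_gt0 : 0 < p) (p_lt1 : p < 1) (rho : R)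
  (xdag_dom : dom (spectral_power E p) xdag)
  (xdag_smooth : `|spectral_power E p (xdag - xbar)| <= rho)
  (xdag_int : interior (dom F) xdag)
  (xdag_notB : ~ dom B xdag) :
  exists K0 delta0 : R, [/\ 0 < K0, 0 < delta0 &
    forall delta : R, 0 < delta -> delta <= delta0 ->
    forall yd : Y, `|y - yd| <= delta ->
    forall x : X,
      is_tikhonov_minimizer F B
        (delta `^ (2 * (a + 1) / (a + p))) yd xbar x ->
      `|x - xdag| <= K0 * delta `^ (p / (a + p))].
Proof.
have rho0 : 0 <= rho by apply: le_trans xdag_smooth.
have sqle (b c : R) : 0 <= b -> b <= c -> b ^+ 2 <= c ^+ 2.
  by move=> b0 bc; rewrite lerXn2r ?nnegrE// (le_trans b0).
have ap0 : 0 < a + p by rewrite addr_gt0.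
have [e /= e0 eF] : exists2 e, 0 < e & ball xdag e `<=` dom F.
  by move/nbhs_ballP: xdag_int.
pose w := xdag - xbar.
have wp : dom (spectral_power E p) w.
  apply: spectral_domB => //; first exact: measurable_norm_powR.
  exact: (sub_dom_spectral_power m_gt0 BE B_below (ltW p_lt1) xbarD.2).
(* [C2] bounds the functional at xbar + v in units of delta^2: the first square is the residual
   including noise, the second the penalty. *)
pose C2 := (C_a * rho + 1) ^+ 2 + rho ^+ 2.
have C20 : 0 <= C2 by rewrite addr_ge0 ?sqr_ge0.
(* The first summand will bound the squared (-a)-norm of [z], the second |B z|^2, up to powers of
   [s]. *)
pose K2 := 2 * (2 * (C2 + 1) / c_a ^+ 2 + rho ^+ 2) + 2 * (C2 + rho ^+ 2).
have K20 : 0 <= K2.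
  have q0 : 0 <= 2 * (C2 + 1) / c_a ^+ 2.
    by rewrite divr_ge0 ?sqr_ge0// mulr_ge0// addr_ge0.
  by have := sqr_ge0 rho; rewrite /K2; lra.
(* With t = 2 (K2 + rho^2), the bound t <= (1 + t)^2 avoids a square root. The choice of delta0
   gives s^p <= e / (rho + 1), where adding 1 covers rho = 0. *)
exists (1 + 2 * (K2 + rho ^+ 2)), ((e / (rho + 1)) `^ ((a + p) / p)).
have e1 : 0 < e / (rho + 1) by rewrite divr_gt0// ltr_wpDl.
split; [|by rewrite powR_gt0|].
  by rewrite ltr_pwDl// mulr_ge0// addr_ge0// sqr_ge0.
move=> delta d0 dd0 yd ydd x [[xF xB] xmin].
pose s := delta `^ (a + p)^-1.
have s0 : 0 < s by rewrite powR_gt0.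
have sE t : s `^ t = delta `^ (t / (a + p)) by rewrite -powRrM mulrC.
(* In these terms delta = Q P and alpha = (Q s)^2, so every later estimate is rational in P, Q and
   s. *)
pose P := s `^ p; pose Q := s `^ a.
have P0 : 0 < P by rewrite powR_gt0.
have Q0 : 0 < Q by rewrite powR_gt0.
have dE : delta = Q * P.
  rewrite -powRD ?(gt_eqF s0) ?implybT// sE divff ?gt_eqF//.
  by rewrite powRr1 ?ltW.
have aE : delta `^ (2 * (a + 1) / (a + p)) = (Q * s) ^+ 2.
  rewrite -sE mulrC powRrM -[2]/(2%:R) powR_mulrn ?powR_ge0//.
  by rewrite powRD ?(gt_eqF s0) ?implybT// powRr1// ltW.
rewrite -sE -/P.
have Prho : P * rho < e.
  have Pe : P <= e / (rho + 1).
    have -> : e / (rho + 1) =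
        ((e / (rho + 1)) `^ ((a + p) / p)) `^ (p / (a + p)).
      by rewrite -powRrM mulf_div [p * _]mulrC divff ?powRr1 ?ltW// mulf_neq0 ?gt_eqF.
    rewrite /P sE; apply: ge0_ler_powR; rewrite ?nnegrE ?powR_ge0//.
      by rewrite divr_ge0 ?ltW.
    exact: ltW.
  rewrite ler_pdivlMr ?ltr_wpDl// in Pe; apply: lt_le_trans Pe.
  by rewrite ltr_pM2l// ltrDl.
have [v [vB vw vN Bv]] := spectral_cutoff m_gt0 BE B_below a_gt0 p_gt0 p_lt1 s0
  wp xdag_smooth.
have vE : xbar + v - xdag = v - w by rewrite /w opprB addrA [v + xbar]addrC.
(* Interiority of [xdag] enters here: xbar + v is at distance at most P rho < e from it. *)
have zF : (dom F `&` dom B) (xbar + v).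
  split; last first.
    by move: vB xbarD.2; rewrite !(domB BE) => vB xB'; exact: spectral_domD.
  apply: eF; rewrite -ball_normE /= distrC vE.
  exact: le_lt_trans Prho.
have sp1 : s `^ (p - 1) = P / s.
  by rewrite powRD ?(gt_eqF s0) ?implybT// powR_inv1// (ltW s0).
have sap : s `^ (a + p) = Q * P by rewrite powRD ?(gt_eqF s0) ?implybT.
have sna : s `^ (- a) = Q^-1 by rewrite powRN.
rewrite sp1 in Bv; rewrite sap in vN.
have N0 u : 0 <= scale_norm E (- a) u by exact: normr_ge0.
have Ca0 : 0 < C_a by exact: lt_le_trans cC_a.
have Cr0 : 0 <= C_a * rho + 1 by rewrite addr_ge0// mulr_ge0// ltW.
have QP0 : 0 <= Q * P by rewrite mulr_ge0 ?ltW.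
have T1 : tikhonov F B (delta `^ (2 * (a + 1) / (a + p))) yd xbar x <=
    (Q * P) ^+ 2 * C2.
  apply: le_trans (xmin _ zF) _; rewrite /tikhonov aE addrAC subrr add0r.
  have F1 : `|F (xbar + v) - yd| <= Q * P * (C_a * rho + 1).
    rewrite -(subrK (F xdag) (F (xbar + v))) -addrA.
    apply: le_trans (ler_normD _ _) _.
    have := (F_struct _ zF).2; rewrite vE Fxdag => H.
    rewrite mulrDr mulr1; apply: lerD; last by rewrite -dE.
    by apply: le_trans H _; rewrite mulrCA ler_wpM2l// (ltW Ca0).
  rewrite /C2 mulrDr; apply: lerD.
    by rewrite -exprMn sqle.
  rewrite -!exprMn sqle//; first by rewrite !mulr_ge0// ltW.
  apply: (@le_trans _ _ (Q * s * (P / s * rho))).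
    by rewrite ler_wpM2l// mulr_ge0// ltW.
  by rewrite mulrA -[Q * s * _]mulrA [s * _]mulrC divfK ?gt_eqF.
have FQ : `|F x - yd| ^+ 2 <= (Q * P) ^+ 2 * C2.
  by apply: le_trans T1; rewrite lerDl mulr_ge0 ?powR_ge0 ?sqr_ge0.
(* Dividing the penalty by alpha = (Q s)^2 leaves the factor (P / s)^2. *)
have BQ : `|B (x - xbar)| ^+ 2 <= (P / s) ^+ 2 * C2.
  have : (Q * s) ^+ 2 * `|B (x - xbar)| ^+ 2 <= (Q * P) ^+ 2 * C2.
    by rewrite -aE; apply: le_trans T1; rewrite lerDr sqr_ge0.
  have Qs : 0 < (Q * s) ^+ 2 by rewrite exprn_gt0 ?mulr_gt0.
  rewrite mulrC -ler_pdivlMr// => /le_trans; apply.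
  rewrite le_eqVlt; apply/orP; left; apply/eqP; field.
  by rewrite !gt_eqF.
(* The lower structural bound converts the residual into a (-a)-norm; in C2 + 1 the 1 accounts for
   the data noise. *)
have NQ : scale_norm E (- a) (x - xdag) ^+ 2 <=
    (Q * P) ^+ 2 * (2 * (C2 + 1) / c_a ^+ 2).
  rewrite mulrA ler_pdivlMr ?exprn_gt0// mulrC -exprMn.
  apply: (@le_trans _ _ (`|F x - F xdag| ^+ 2)).
    apply: sqle; first by rewrite mulr_ge0// ltW.
    exact: (F_struct _ (conj xF xB)).1.
  rewrite -(subrK yd (F x)) -addrA; apply: le_trans (normD_sqr_le _ _) _.
  rewrite mulrCA ler_wpM2l// mulrDr mulr1 lerD//.
  by rewrite sqle// Fxdag distrC -dE.
(* This form suits the (-a)-norm. Since [xdag] is outside [dom B], the estimate of B z uses the form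
   (x - xbar) - v, whose terms both lie in the domain. *)
pose z := (x - xdag) - (v - w).
have zB : z = (x - xbar) - v.
  by rewrite /z /w opprB addrA subrKA.
have Nz : scale_norm E (- a) z ^+ 2 <=
    2 * ((Q * P) ^+ 2 * (2 * (C2 + 1) / c_a ^+ 2 + rho ^+ 2)).
  apply: le_trans (scale_normN_sqrB_le m_gt0 BE B_below _ _ a_gt0) _.
  rewrite ler_wpM2l// mulrDr lerD// -exprMn.
  by rewrite sqle.
have xbB : dom B (x - xbar) by apply: (domBB BE) => //; exact: xbarD.2.
have Bz : `|B z| ^+ 2 <= 2 * ((P / s) ^+ 2 * (C2 + rho ^+ 2)).
  rewrite zB; apply: le_trans (normB_sqrB_le BE xbB vB) _.
  rewrite ler_wpM2l// mulrDr lerD// -exprMn.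
  by rewrite sqle.
(* Interpolation at this [s] has weights Q^(-2) and s^2, which cancel the factors Q^2 and s^(-2) of
   the two bounds and leave P^2. *)
have zK : `|z| ^+ 2 <= P ^+ 2 * K2.
  have dz : dom B z by rewrite zB; exact: (domBB BE).
  apply: le_trans (interpolation m_gt0 BE B_below a_gt0 s0 dz) _.
  rewrite sna.
  have H1 := ler_wpM2l (sqr_ge0 Q^-1) Nz.
  have H2 := ler_wpM2l (sqr_ge0 s) Bz.
  apply: le_trans (lerD H1 H2) _.
  rewrite le_eqVlt; apply/orP; left; apply/eqP; rewrite /K2; field.
  by rewrite !gt_eqF.
have xK : `|x - xdag| ^+ 2 <= P ^+ 2 * (2 * (K2 + rho ^+ 2)).
  rewrite -(subrK (v - w) (x - xdag)); apply: le_trans (normD_sqr_le _ _) _.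
  rewrite mulrCA ler_wpM2l// mulrDr lerD// -exprMn.
  by rewrite sqle.
have K0 : 0 <= 2 * (K2 + rho ^+ 2) by rewrite mulr_ge0// addr_ge0// sqr_ge0.
rewrite mulrC -(@ler_pXn2r _ 2) ?nnegrE ?mulr_ge0 ?addr_ge0 ?(ltW P0)//.
apply: le_trans xK _; rewrite exprMn ler_wpM2l ?sqr_ge0//.
nra.
Qed.
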